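(* Every $3$-way $3$-homogeneous $(v,3,2)$ Steiner trade of volume $v$ contains, as a subtrade, a $3$-way $3$-homogeneous $(u,3,2)$ Steiner trade of volume $8$ or $9$.
   Context: Let $V$ be a finite set with $v$ elements and let $t<k<v$ be positive integers. A $\mu$-way $(v,k,t)$ trade $T=\{T_1,\dots,T_\mu\}$ of volume $m$ consists of $\mu$ pairwise disjoint collections $T_1,\dots,T_\mu$, each of $m$ blocks ($k$-subsets of $V$), such that every $t$-subset of $V$ is contained in the same number of blocks in each $T_i$. The foundation $\mathrm{found}(T)$ is the set of elements covered by the blocks. It is a Steiner trade if every $t$-subset of $\mathrm{found}(T)$ is in at most one block of each $T_i$, and $d$-homogeneous if every element of $V$ lies in exactly $d$ blocks of each $T_i$. A trade $T'=\{T'_1,\dots,T'_\mu\}$ is a subtrade of $T=\{T_1,\dots,T_\mu\}$ if $T'_i\subseteq T_i$ for all $1\le i\le\mu$. *)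

(* Defs.v *)
From mathcomp Require Import all_boot.

Set Implicit Arguments.
Unset Strict Implicit.
Unset Printing Implicit Defensive.

Section Trades.

Variables (E : finType) (mu : nat).

(* The collections T_1, ..., T_mu are sets of blocks, indexed from 0.  Sets lose
   nothing for Steiner trades: a repeated block would put each of its t-subsets
   in two blocks of the same collection. *)
Implicit Types (V S B : {set E}) (T : 'I_mu -> {set {set E}}).

Definition blocks_containing T i S : {set {set E}} :=
  [set B in T i | S \subset B].

Record is_trade (v k t m : nat) V T : Prop := IsTrade {
  trade_order : #|V| = v;
  trade_parameters : [&& 0 < t, t < k & k < v];
  trade_blocks : forall i B, B \in T i -> B \subset V /\ #|B| = k;
  trade_volume : forall i, #|T i| = m;
  trade_disjoint : forall i j, i != j -> [disjoint T i & T j];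
  trade_balanced : forall S, S \subset V -> #|S| = t ->
    forall i j, #|blocks_containing T i S| = #|blocks_containing T j S|
}.

Definition found T : {set E} := \bigcup_(i < mu) cover (T i).

Definition steiner (t : nat) T : Prop :=
  forall S, S \subset found T -> #|S| = t ->
  forall i, #|blocks_containing T i S| <= 1.

Definition homogeneous (d : nat) V T : Prop :=
  forall x, x \in V -> forall i, #|[set B in T i | x \in B]| = d.

Definition subtrade T' T : Prop := forall i, T' i \subset T i.

Definition homogeneous_steiner_trade (d v k t m : nat) V T : Prop :=
  [/\ is_trade v k t m V T, steiner t T & homogeneous d V T].

End Trades.

(* Main.v *)
(* Join two points when some block contains both; by balance this graph is the
   same for the three collections, and it is 6-regular because the three blocks
   of T_i through a point meet only there.  Every edge ab lies in exactly one
   block of each T_i, and the three blocks differ, so the trade is very rigid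
   locally: growing a partial trade outwards from a single point, naming new
   points only when they are met, gives a finite case analysis (about 500 cases)
   in which every branch either contradicts one of these facts or stops at a
   connected component of 8 or 9 points.  The blocks inside that component form
   the subtrade. *)
Require Import Defs.
From mathcomp Require Import all_boot.

Set Implicit Arguments.
Unset Strict Implicit.
Unset Printing Implicit Defensive.

(** * The finite search over partial trades *)

(* A partial trade consists of adjacency lists G, of points named by their index
   in G, and of a list L of known blocks, each with its collection. *)

(* Two blocks of one collection sharing two points must coincide, and two blocks
   of different collections cannot coincide. *)
Definition compatible (C D : 'I_3 * seq nat) : bool :=
  count (mem D.2) C.2 != (if C.1 == D.1 then 2 else 3).

(** Only [z <= size G] occurs, so an index out of range is exactly the next fresh name. *)
Definition grow (G : seq (seq nat)) (z : nat) : seq (seq nat) :=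
  if z < size G then G else rcons G [::].

Definition add_arc (x y : nat) (G : seq (seq nat)) : seq (seq nat) :=
  if y \in nth [::] G x then G else set_nth [::] G x (y :: nth [::] G x).

Definition add_edge (x y : nat) (G : seq (seq nat)) : seq (seq nat) :=
  add_arc x y (add_arc y x G).

(** [Third i x y] asks which point completes the edge [xy] to a block of collection [i];
    [Neighbour x] asks for a neighbour of [x] not yet listed. *)
Inductive query := Third of 'I_3 & nat & nat | Neighbour of nat.

Definition colours : seq 'I_3 :=
  [:: @Ordinal 3 0 isT; @Ordinal 3 1 isT; @Ordinal 3 2 isT].

(* The order of the queries only affects the size of the search: finishing one
   point before the next, one collection at a time, keeps it small. *)
Definition queries G (L : seq ('I_3 * seq nat)) : seq query :=
  flatten [seq
    [seq Third i x y | i <- colours, y <- [seq y <- nth [::] G x |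
       ~~ has (fun D => [&& D.1 == i, x \in D.2 & y \in D.2]) L]]
    ++ (if size (nth [::] G x) < 6 then [:: Neighbour x] else [::])
  | x <- iota 0 (size G)].

Definition complete (G : seq (seq nat)) : bool :=
  [&& (size G == 8) || (size G == 9) & all (fun l => 6 <= size l) G].

(* The new point z ranges over the named points and the fresh name size G.  The
   conditionals, unlike && and ==>, keep the virtual machine from evaluating the
   pruned branches. *)
Fixpoint search (fuel : nat) G L : bool :=
  if fuel isn't fuel'.+1 then false else
  if complete G then true else
  if ~~ all (fun l => size l <= 6) G then true else
  match ohead (queries G L) with
  | Some (Third i x y) =>
      (* The query is validated here, so soundness does not depend on how [queries] chose it. *)
      [&& x < size G, y \in nth [::] G x &
        all (fun z =>
               if uniq [:: x; y; z] && all (compatible (i, [:: x; y; z])) L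
               then search fuel'
                 (add_edge x y (add_edge x z (add_edge y z (grow G z))))
                 ((i, [:: x; y; z]) :: L)
               else true)
            (iota 0 (size G).+1)]
  | Some (Neighbour x) =>
      [&& x < size G, size (nth [::] G x) < 6 &
        all (fun z => if (z != x) && (z \notin nth [::] G x)
               then search fuel' (add_edge x z (grow G z)) L else true)
            (iota 0 (size G).+1)]
  | None => false
  end.

(** The start is a single point with nothing known about it. Exhausted fuel yields [false], so
    success shows that depth 40 is enough for every branch. *)
Lemma search_from_vertex : search 40 [:: [::]] [::].
Proof. by vm_compute. Qed.

(** Double counting of the incident pairs of a point and a block. *)
Lemma sum_incidences (I : finType) (U : {set I}) (P : {set {set I}}) :
  (forall B, B \in P -> B \subset U) ->
  \sum_(x in U) #|[set B in P | x \in B]| = \sum_(B in P) #|B|.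
Proof.
move=> PU.
have -> : \sum_(x in U) #|[set B in P | x \in B]| =
          \sum_(x in U) \sum_(B in P) (x \in B : nat).
  apply: eq_bigr => x _; rewrite -sum1_card big_mkcond [RHS]big_mkcond /=.
  by apply: eq_bigr => B _; rewrite inE; case: (B \in P); case: (x \in B).
rewrite exchange_big; apply: eq_bigr => B BP.
rewrite -sum1_card big_mkcond [RHS]big_mkcond /=; apply: eq_bigr => x _.
have /subsetP/(_ x) := PU B BP.
by case: (x \in B) => // [->|_] //; case: (x \in U).
Qed.

(** * Local structure of the trade: blocks through an edge and the 6-regular graph *)

Section Trade.

Variables (E : finType) (v : nat) (V : {set E}) (T : 'I_3 -> {set {set E}}).
Hypothesis trT : homogeneous_steiner_trade 3 v 3 2 v V T.

Definition neighbours (a : E) : {set E} :=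
  cover [set B in T ord0 | a \in B] :\ a.

Lemma block_unique i a b B C :
    a != b -> B \in T i -> C \in T i -> a \in B -> b \in B -> a \in C ->
  b \in C -> B = C.
Proof.
case: trT => tr st _ ab BT CT aB bB aC bC.
suff /card_le1_eqP : #|blocks_containing T i [set a; b]| <= 1.
  apply; rewrite inE ?BT ?CT; apply/subsetP => c.
    by rewrite !inE => /orP [] /eqP ->.
  by rewrite !inE => /orP [] /eqP ->.
apply: st; rewrite ?cards2 ?ab //.
(* The Steiner condition only concerns pairs inside the foundation; here [B] itself covers the
   pair. *)
rewrite /found; apply/subsetP => c; rewrite !inE => /orP cab.
apply/bigcupP; exists i => //; apply/bigcupP; exists B => //.
by case: cab => /eqP ->.
Qed.

(** Deleting [a] from the three blocks of [T ord0] through it leaves three disjoint pairs. *)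
Lemma card_neighbours a : a \in V -> #|neighbours a| = 6.
Proof.
case: (trT) => tr _ ho aV; rewrite /neighbours.
set P := [set B in T ord0 | a \in B].
have -> : cover P :\ a = cover [set B :\ a | B in P].
  rewrite /cover big_imset /=; last first.
    move=> B C; rewrite !inE => /andP [_ aB] /andP [_ aC] e.
    by rewrite -(setD1K aB) -(setD1K aC) e.
  apply/setP => b; rewrite !inE; apply/andP/bigcupP.
    by case=> ba /bigcupP [B BP bB]; exists B => //; rewrite !inE ba.
  case=> B BP; rewrite !inE => /andP [-> bB]; split=> //.
  by apply/bigcupP; exists B.
have /eqP <- : trivIset [set B :\ a | B in P].
  apply/trivIsetP => _ _ /imsetP [B + ->] /imsetP [C + ->].
  rewrite !inE => /andP [BT aB] /andP [CT aC] neq.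
  rewrite -setI_eq0; apply: contraNT neq => /set0Pn [b].
  rewrite !inE => /andP [/andP [ba bB] /andP [_ bC]].
  by rewrite (block_unique _ BT CT bB aB bC aC).
rewrite big_imset /=; last first.
  move=> B C; rewrite !inE => /andP [_ aB] /andP [_ aC] e.
  by rewrite -(setD1K aB) -(setD1K aC) e.
rewrite (eq_bigr (fun=> 2)); first by rewrite sum_nat_const ho.
move=> B; rewrite inE => /andP [BT aB].
by have [_] := trade_blocks tr BT; rewrite (cardsD1 a) aB => -[].
Qed.

Lemma block_in_order i B a : B \in T i -> a \in B -> a \in V.
Proof.
by case: trT => tr _ _ BT; have [/subsetP BV _] := trade_blocks tr BT; apply: BV.
Qed.

Lemma common_block i j B a b :
    B \in T i -> a \in B -> b \in B -> a != b ->
  exists C, [/\ C \in T j, a \in C & b \in C].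
Proof.
case: (trT) => tr _ _ BT aB bB ab.
have sub2 (C : {set E}) : ([set a; b] \subset C) = (a \in C) && (b \in C).
  by rewrite subUset !sub1set.
have abV : [set a; b] \subset V.
  by rewrite sub2 (block_in_order BT aB) (block_in_order BT bB).
have := trade_balanced tr abV _ i j; rewrite cards2 ab => /(_ erefl) e.
have : 0 < #|blocks_containing T j [set a; b]|.
  by rewrite -e; apply/card_gt0P; exists B; rewrite inE BT sub2 aB.
by case/card_gt0P => C; rewrite inE sub2 => /and3P [CT aC bC]; exists C.
Qed.

Lemma block_neighbours i B a b :
  B \in T i -> a \in B -> b \in B -> a != b -> b \in neighbours a.
Proof.
move=> BT aB bB ab; have [C [CT aC bC]] := common_block ord0 BT aB bB ab.
rewrite !inE eq_sym ab; apply/bigcupP; exists C => //.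
by rewrite inE CT.
Qed.

(** Balance carries a block through the pair from one collection to any other, so adjacency does not
    depend on [ord0]. *)
Lemma neighboursP i a b :
  reflect (a != b /\ exists B, [/\ B \in T i, a \in B & b \in B])
          (b \in neighbours a).
Proof.
apply: (iffP idP); last first.
  by case=> ab [B [BT aB bB]]; apply: block_neighbours BT aB bB ab.
rewrite !inE eq_sym => /andP [ab /bigcupP [B]]; rewrite inE => /andP [BT aB] bB.
by split=> //; apply: common_block BT aB bB ab.
Qed.

Lemma neighboursC a b : (a \in neighbours b) = (b \in neighbours a).
Proof.
by apply/idP/idP => /(neighboursP ord0) [ab [B [BT aB bB]]];
  apply: block_neighbours BT bB aB _; rewrite eq_sym.
Qed.

Lemma neighbour_in_order a b : b \in neighbours a -> b \in V.
Proof. by case/(neighboursP ord0) => _ [B [BT _]]; apply: block_in_order BT. Qed.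

Lemma third_point i a b :
  b \in neighbours a ->
  exists c, [/\ c \in V, uniq [:: a; b; c] & [set a; b; c] \in T i].
Proof.
case: (trT) => tr _ _.
case/(neighboursP i) => ab [B [BT aB bB]].
have [_ cB] := trade_blocks tr BT.
have : 0 < #|B :\ a :\ b|.
  move: cB; rewrite (cardsD1 a) aB (cardsD1 b) !inE bB (eq_sym b) ab.
  by case: #|_|.
case/card_gt0P => c; rewrite !inE => /and3P [cb ca cinB].
have u : uniq [:: a; b; c].
  by rewrite /= !inE negb_or ab (eq_sym a) ca (eq_sym b) cb.
exists c; split=> //; first exact: block_in_order BT cinB.
suff -> : [set a; b; c] = B by [].
apply/eqP; rewrite eqEcard cB; apply/andP; split.
  by rewrite !subUset !sub1set aB bB cinB.
move: u => /= /andP []; rewrite !inE negb_or => /andP [_ ac] /andP [bc _].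
by rewrite -setUA cardsU1 !inE negb_or ab ac cards2 bc.
Qed.

(** * Partial trades realized by actual points *)

Variable a0 : E.

Definition realized_block (s : seq E) (C : 'I_3 * seq nat) : Prop :=
  [/\ all (gtn (size s)) C.2, uniq C.2, size C.2 = 3 &
      [set a in map (nth a0 s) C.2] \in T C.1].

(* The points of the trade named by the indices of G are listed in s. *)
Record realizes (s : seq E) (G : seq (seq nat)) (L : seq ('I_3 * seq nat)) :
    Prop := Realizes {
  realizes_uniq : uniq s;
  realizes_order : {subset s <= V};
  realizes_size : size G = size s;
  realizes_uniq_adj : forall l, l \in G -> uniq l;
  realizes_arc : forall x y, x < size s -> y \in nth [::] G x ->
    y < size s /\ nth a0 s y \in neighbours (nth a0 s x);
  realizes_blocks : forall C, C \in L -> realized_block s C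
}.

(** The counterpart of [grow]: in both cases [p] gets the name [index p s], which equals [size s]
    when [p] is new. *)
Definition extend (s : seq E) (p : E) : seq E :=
  if p \in s then s else rcons s p.

Lemma size_extend s p : size s <= size (extend s p).
Proof. by rewrite /extend; case: ifP; rewrite ?size_rcons. Qed.

Lemma nth_extend s p x : x < size s -> nth a0 (extend s p) x = nth a0 s x.
Proof. by rewrite /extend; case: ifP => // _ lx; rewrite nth_rcons lx. Qed.

Lemma nth_extend_index s p : nth a0 (extend s p) (index p s) = p.
Proof.
rewrite /extend; case: ifP => [/nth_index -> // | /negbT /memNindex ->].
by rewrite nth_rcons ltnn eqxx.
Qed.

Lemma index_lt_extend s p : index p s < size (extend s p).
Proof.
rewrite /extend; case: ifP; first by rewrite index_mem.
by rewrite size_rcons ltnS index_size.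
Qed.

Lemma realizes_grow s G L p :
  p \in V -> realizes s G L -> realizes (extend s p) (grow G (index p s)) L.
Proof.
move=> pV [us sV sG uG arc bl]; split.
- by rewrite /extend; case: ifP => // /negbT ps; rewrite rcons_uniq ps.
- rewrite /extend; case: ifP => // _ a; rewrite mem_rcons inE.
  by case/orP => [/eqP -> // | /sV].
- rewrite /grow /extend sG index_mem; case: ifP => //.
  by rewrite !size_rcons sG.
- rewrite /grow; case: ifP => // _ l; rewrite mem_rcons inE.
  by case/orP => [/eqP -> // | /uG].
- move=> x y lx; rewrite /grow sG index_mem => hy.
  (* A fresh point starts with an empty list, so every arc leaves an old point. *)
  have [lxs yx] : x < size s /\ y \in nth [::] G x.
    move: lx hy; rewrite /extend; case: ifP => // _.
    rewrite size_rcons ltnS leq_eqVlt nth_rcons sG => /orP [/eqP ->|lx].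
      by rewrite ltnn eqxx.
    by rewrite lx.
  have [lys yn] := arc x y lxs yx.
  by rewrite !nth_extend // (leq_trans lys (size_extend s p)).
- case=> i l /bl [/= ll ul sl lT]; split=> //=.
    by apply: sub_all ll => x /= lx; apply: leq_trans (size_extend s p).
  suff -> : map (nth a0 (extend s p)) l = map (nth a0 s) l by [].
  by apply/eq_in_map => x /(allP ll) /= lx; rewrite nth_extend.
Qed.

Lemma realizes_add_arc s G L x y :
    x < size s -> y < size s -> nth a0 s y \in neighbours (nth a0 s x) ->
  realizes s G L -> realizes s (add_arc x y G) L.
Proof.
move=> lx ly xy [us sV sG uG arc bl]; rewrite /add_arc; case: ifP => // /negbT nxy.
split=> //.
- by rewrite size_set_nth sG (maxn_idPr _).
- move=> l; case/(nthP [::]) => z; rewrite size_set_nth sG (maxn_idPr lx) => lz <-.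
  rewrite nth_set_nth /=; case: eqP => _; last by rewrite uG // mem_nth // sG.
  by rewrite /= nxy uG // mem_nth // sG.
- move=> z w lz; rewrite nth_set_nth /=; case: eqP => [-> | _]; last exact: arc.
  by rewrite inE => /orP [/eqP -> | /(arc x w lx)].
Qed.

Lemma realizes_add_edge s G L x y :
    x < size s -> y < size s -> nth a0 s y \in neighbours (nth a0 s x) ->
  realizes s G L -> realizes s (add_edge x y G) L.
Proof.
move=> lx ly xy re; apply: realizes_add_arc => //.
by apply: realizes_add_arc => //; rewrite neighboursC.
Qed.

Lemma map_adjacency_sub s G L x :
  realizes s G L -> x < size s ->
  {subset map (nth a0 s) (nth [::] G x) <= neighbours (nth a0 s x)}.
Proof. by move=> re lx _ /mapP [y /(realizes_arc re lx) [_ ?] ->]. Qed.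

Lemma uniq_map_adjacency s G L x :
  realizes s G L -> x < size s -> uniq (map (nth a0 s) (nth [::] G x)).
Proof.
move=> re lx; rewrite map_inj_in_uniq.
  by apply: (realizes_uniq_adj re); rewrite mem_nth // (realizes_size re).
move=> y z /(realizes_arc re lx) [ly _] /(realizes_arc re lx) [lz _] /eqP.
by rewrite nth_uniq ?(realizes_uniq re) // => /eqP.
Qed.

Lemma realized_degree s G L x :
  realizes s G L -> x < size s -> size (nth [::] G x) <= 6.
Proof.
move=> re lx; rewrite -(@card_neighbours (nth a0 s x)); last first.
  by apply: (realizes_order re); rewrite mem_nth.
rewrite -(size_map (nth a0 s)) -(card_uniqP (uniq_map_adjacency re lx)).
by apply/subset_leq_card/subsetP/(map_adjacency_sub re lx).
Qed.

Lemma mem_map_nth s l x :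
    uniq s -> all (gtn (size s)) l -> x < size s ->
  (nth a0 s x \in map (nth a0 s) l) = (x \in l).
Proof.
move=> us /allP ll lx; apply/mapP/idP => [[y yl /eqP] | xl]; last by exists x.
by rewrite nth_uniq // => [/eqP -> | ]; last exact: ll yl.
Qed.

Lemma realized_compatible s C D :
  uniq s -> realized_block s C -> realized_block s D -> compatible C D.
Proof.
case: (trT) => tr _ _ us.
case: C D => [i k] [j l] [/= lk uk sk kT] [/= ll ul sl lT].
rewrite /compatible /=; case: (i =P j) => [eij | /eqP nij]; last first.
  (* Three common indices make the two triples the same block, against disjointness of the
     collections. *)
  apply: contraTneq lT => c3.
  have kl : {subset k <= l}.
    by apply/allP; rewrite all_count c3 sk.
  have [_ ekl] := uniq_min_size uk kl (eq_leq (etrans sl (esym sk))).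
  suff <- : [set a in map (nth a0 s) k] = [set a in map (nth a0 s) l].
    by have /disjointFr -> := trade_disjoint tr nij.
  by apply/setP => a; rewrite !inE; apply: eq_mem_map.
apply/eqP; subst j.
rewrite -size_filter => c2.
have uf : uniq (filter (mem l) k) by rewrite filter_uniq.
have mf x : x \in filter (mem l) k -> (x \in k) && (x \in l).
  by rewrite mem_filter andbC.
case: (filter _ _) (c2) uf mf => [|x [|y [|//]]] //= _.
rewrite inE andbT => nxy mf.
have /andP [xk xl] := mf x (mem_head _ _).
have /andP [yk yl] : (y \in k) && (y \in l) by apply: mf; rewrite !inE eqxx orbT.
have lx : x < size s := allP lk _ xk.
have ly : y < size s := allP lk _ yk.
have e : [set a in map (nth a0 s) k] = [set a in map (nth a0 s) l].
  apply: (@block_unique i (nth a0 s x) (nth a0 s y)) kT lT _ _ _ _;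
    by rewrite ?nth_uniq // inE mem_map_nth.
(* Two common points force equal blocks, hence three common indices, contradicting the count of
   two. *)
have kl : all (mem l) k.
  apply/allP => w wk; have lw : w < size s := allP lk _ wk.
  by move/setP/(_ (nth a0 s w)): e; rewrite !inE !mem_map_nth // wk => <-.
by move: c2 kl; rewrite size_filter all_count sk => ->.
Qed.

(** Six listed neighbours already exhaust a neighbourhood of size 6, so no edge leaves the named
    points. *)
Lemma complete_closed s G L a b :
    realizes s G L -> complete G -> a \in s -> b \in neighbours a ->
  b \in s.
Proof.
move=> re /andP [_ /allP deg] /(nthP a0) [x lx <-].
set l := map (nth a0 s) (nth [::] G x).
have card_l : 6 <= #|l|.
  rewrite (card_uniqP (uniq_map_adjacency re lx)) size_map.
  by apply: deg; rewrite mem_nth // (realizes_size re).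
have sub : l \subset neighbours (nth a0 s x).
  exact/subsetP/(map_adjacency_sub re lx).
have : neighbours (nth a0 s x) \subset l.
  rewrite -(geq_leqif (subset_leqif_card sub)) card_neighbours //.
  by apply: (realizes_order re); rewrite mem_nth.
move=> /subsetP h /h /mapP [y /(realizes_arc re lx) [ly _] ->].
exact: mem_nth.
Qed.

(** * Soundness of the search *)

Definition has_closed_set : Prop :=
  exists U : {set E}, [/\ U \subset V, (#|U| == 8) || (#|U| == 9) &
    forall a, a \in U -> neighbours a \subset U].

(** The true answer to each query is among the branches tried, and a partial trade realized in [T]
    is never pruned; following the true answers must therefore end at a complete partial trade. *)
Lemma search_sound fuel s G L :
  realizes s G L -> search fuel G L -> has_closed_set.
Proof.
elim: fuel s G L => // fuel IH s G L re; rewrite /search -/search.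
case: ifP => [cG _ | _].
  exists [set a in s]; split.
  - by apply/subsetP => a; rewrite inE; apply: realizes_order re _.
  - rewrite cardsE (card_uniqP (realizes_uniq re)) -(realizes_size re).
    by case/andP: cG.
  - move=> a; rewrite inE => sa; apply/subsetP => b; rewrite inE.
    exact: complete_closed re cG sa.
case: ifP => [/negP [] | _].
  apply/allP => l /(nthP [::]) [x]; rewrite (realizes_size re) => lx <-.
  exact: realized_degree re lx.
have index_range p : index p s \in iota 0 (size G).+1.
  by rewrite mem_iota /= ltnS (realizes_size re) index_size.
case: (ohead _) => [[i x y | x]|] //; rewrite (realizes_size re) => /and3P [lx].
- move=> yx; rewrite -(realizes_size re) => /allP ok.
  have [ly xy] := realizes_arc re lx yx.
  (* The branch to follow is the name of the actual third point [p]. *)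
  have [p [pV up pT]] := third_point i xy.
  have := ok (index p s) (index_range p); set z := index p s => {}ok.
  have le := size_extend s p.
  have lx' := leq_trans lx le; have ly' := leq_trans ly le.
  have lz' := index_lt_extend s p; rewrite -/z in lz'.
  have re' := realizes_grow pV re; rewrite -/z in re'.
  have us' := realizes_uniq re'.
  have ex := nth_extend p lx; have ey := nth_extend p ly.
  have ez := nth_extend_index s p; rewrite -/z in ez.
  have eU : map (nth a0 (extend s p)) [:: x; y; z] =
      [:: nth a0 s x; nth a0 s y; p] by rewrite /= ex ey ez.
  have ub : uniq [:: x; y; z].
    by apply: (@map_uniq _ _ (nth a0 (extend s p))); rewrite eU.
  have bl : realized_block (extend s p) (i, [:: x; y; z]).
    split=> //; first by rewrite /= lx' ly' lz'.
    suff -> : [set a in map (nth a0 (extend s p)) [:: x; y; z]] =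
       [set nth a0 s x; nth a0 s y; p] by [].
    by rewrite eU; apply/setP => a; rewrite !inE orbA.
  move: ok; rewrite ub.
  have -> : all (compatible (i, [:: x; y; z])) L.
    apply/allP => C CL; apply: realized_compatible us' bl _.
    exact: (realizes_blocks re').
  apply: IH (extend s p) _ _ _.
  have nbr u w : u \in [:: x; y; z] -> w \in [:: x; y; z] -> u != w ->
    nth a0 (extend s p) w \in neighbours (nth a0 (extend s p) u).
    move=> ub' wb nuw; have [/allP lb _ _ bT] := bl.
    have lu := lb u ub'; have lw := lb w wb.
    by apply: block_neighbours bT _ _ _; rewrite ?nth_uniq // in_set map_f.
  move: ub; rewrite /= !inE negb_or => /and3P [/andP [nxy nxz] nyz _].
  have re3 : realizes (extend s p)
     (add_edge x y (add_edge x z (add_edge y z (grow G z)))) L.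
    by do 3! (apply: realizes_add_edge => //;
      first by apply: nbr; rewrite ?inE ?eqxx ?orbT).
  case: re3 => *; split=> // C; rewrite inE => /orP [/eqP -> // |].
  exact: (realizes_blocks re').
- move=> dx; rewrite -(realizes_size re) => /allP ok.
  (* Fewer than six neighbours are listed, but there are six, so one is missing from the list. *)
  have : exists p, (p \in neighbours (nth a0 s x)) &&
                   (p \notin map (nth a0 s) (nth [::] G x)).
    apply/existsP; rewrite -negb_forall_in; apply: contraTN dx => /forall_inP sub.
    rewrite -leqNgt -(size_map (nth a0 s)) -(@card_neighbours (nth a0 s x)).
      by apply: leq_trans (card_size _); apply/subset_leq_card/subsetP.
    by apply: (realizes_order re); rewrite mem_nth.
  case=> p /andP [px npx].
  have := ok (index p s) (index_range p); set z := index p s => {}ok.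
  have lx' := leq_trans lx (size_extend s p).
  have lz' := index_lt_extend s p; rewrite -/z in lz'.
  have re' := realizes_grow (neighbour_in_order px) re; rewrite -/z in re'.
  have ex := nth_extend p lx.
  have ez := nth_extend_index s p; rewrite -/z in ez.
  move: ok.
  have -> : z != x.
    apply: contraTneq px => ezx.
    by rewrite -ez -ex ezx !inE eqxx.
  have -> : z \notin nth [::] G x.
    apply: contra npx => zx; have [lz _] := realizes_arc re lx zx.
    by rewrite -[p]ez nth_extend // map_f.
  apply: IH; apply: realizes_add_edge re' => //.
  by rewrite ex ez.
Qed.

(** * Restriction of the trade to a closed set of points *)

Lemma restriction_to_closed (U : {set E}) :
    U \subset V -> 3 < #|U| -> (forall a, a \in U -> neighbours a \subset U) ->
  homogeneous_steiner_trade 3 #|U| 3 2 #|U| U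
    (fun i => [set B in T i | B \subset U]).
Proof.
case: (trT) => tr st ho UV U3 closed.
set T' := fun i => _.
(* The other points of a block are neighbours of [a], so a block meeting [U] lies in [U]. Thus
   restriction loses no block at a point of [U]. *)
have block_in i B a : B \in T i -> a \in B -> a \in U -> B \subset U.
  move=> BT aB aU; apply/subsetP => b bB; have [<- // | ab] := eqVneq a b.
  by apply: (subsetP (closed a aU)); apply: block_neighbours BT aB bB ab.
have ho' : homogeneous 3 U T'.
  move=> x xU i; rewrite -(ho x (subsetP UV x xU) i); apply: eq_card => B.
  rewrite !inE; case BT: (B \in T i) => //=; case xB: (x \in B); rewrite ?andbF //.
  by rewrite (block_in i B x).
have same (S : {set E}) i : S \subset U -> #|S| = 2 ->
    blocks_containing T' i S = blocks_containing T i S.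
  move=> SU S2; have /card_gt0P [a aS] : 0 < #|S| by rewrite S2.
  apply/setP => B; rewrite !inE; case BT: (B \in T i) => //=.
  case SB: (S \subset B); rewrite ?andbF ?andbT //.
  by apply: (block_in i B a) => //; [apply: (subsetP SB) | apply: (subsetP SU)].
split=> //; last first.
  move=> S SF S2 i; apply: leq_trans (st S _ S2 i); last first.
    apply: subset_trans SF _; apply/subsetP => a /bigcupP [j _ /bigcupP [B]].
    rewrite inE => /andP [BT _] aB.
    by apply/bigcupP; exists j => //; apply/bigcupP; exists B.
  apply/subset_leq_card/subsetP => B.
  by rewrite !inE => /andP [/andP [-> _] ->].
split=> //.
- move=> i B; rewrite inE => /andP [BT BU]; split=> //.
  by case: (trade_blocks tr BT).
(* Each point is in 3 blocks and each block has 3 points, so double counting gives 3 times the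
   volume equal to 3 times [#|U|]. *)
- move=> i; apply/eqP; rewrite -(eqn_pmul2r (_ : 0 < 3)) //.
  have := @sum_incidences _ U (T' i).
  rewrite (eq_bigr (fun=> 3)) => [|x xU]; last exact: ho'.
  rewrite [RHS](eq_bigr (fun=> 3)) => [|B]; last first.
    by rewrite inE => /andP [BT _]; case: (trade_blocks tr BT).
  rewrite !sum_nat_const => -> // B; by rewrite inE => /andP [].
- move=> i j /(trade_disjoint tr) dij.
  by apply: disjointW dij; apply/subsetP => B; rewrite inE => /andP [].
- move=> S SU S2 i j; rewrite !same //.
  by apply: (trade_balanced tr) => //; apply: subset_trans UV.
Qed.

End Trade.

Theorem theorem2p5 (E : finType) (v : nat) (V : {set E})
    (T : 'I_3 -> {set {set E}}) :
  homogeneous_steiner_trade 3 v 3 2 v V T ->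
  exists (u m : nat) (U : {set E}) (T' : 'I_3 -> {set {set E}}),
    [/\ m = 8 \/ m = 9,
        homogeneous_steiner_trade 3 u 3 2 m U T' &
        subtrade T' T].
Proof.
move=> trT; have [tr _ _] := trT.
(* The search needs a starting point, which exists because [3 < v]. *)
have /card_gt0P [a aV] : 0 < #|V|.
  rewrite (trade_order tr).
  by case/and3P: (trade_parameters tr) => _ _ /(leq_trans _) ->.
have re : realizes V T a [:: a] [:: [::]] [::].
  split=> //.
  - by move=> b; rewrite inE => /eqP ->.
  - by move=> l; rewrite inE => /eqP ->.
  - by case.
have [U [UV card_U closed]] := search_sound trT re search_from_vertex.
exists #|U|, #|U|, U, (fun i => [set B in T i | B \subset U]); split.
- by case/orP: card_U => /eqP ->; [left | right].
- by apply: (restriction_to_closed trT UV _ closed); case/orP: card_U => /eqP ->.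
- by move=> i; apply/subsetP => B; rewrite inE => /andP [].
Qed.
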